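(* Let $\Sigma=\{0,1\}$ and $\varepsilon$ the empty word. The morphism $\varphi:\Sigma^*\times\Sigma^*\to{\rm SL}(3,\mathbb{Q})$ defined on generators by $\varphi((0,\varepsilon))=\begin{pmatrix}4&0&0\\0&\frac12&0\\0&0&\frac12\end{pmatrix}$, $\varphi((1,\varepsilon))=\begin{pmatrix}9&\frac13&0\\0&\frac13&0\\0&0&\frac13\end{pmatrix}$, $\varphi((\varepsilon,0))=\begin{pmatrix}\frac12&0&0\\0&\frac12&0\\0&0&4\end{pmatrix}$, $\varphi((\varepsilon,1))=\begin{pmatrix}\frac13&0&0\\0&\frac13&0\\0&\frac13&9\end{pmatrix}$ is an embedding (an injective morphism).
   Context: $\Sigma^*\times\Sigma^*$ is the direct product monoid of pairs of words with componentwise concatenation, generated by $(0,\varepsilon),(1,\varepsilon),(\varepsilon,0),(\varepsilon,1)$; a morphism is a map preserving products. ${\rm SL}(3,\mathbb{Q})$ is the group of rational $3\times3$ matrices of determinant $1$. *)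

(* Defs.v *)
From HB Require Import structures.
From mathcomp Require Import all_boot all_order all_algebra all_fingroup.

Set Implicit Arguments.
Unset Strict Implicit.
Unset Printing Implicit Defensive.

Import GRing.Theory.
Local Open Scope ring_scope.

(* The free monoid over A; a type alias keeps this monoid structure from being
   attached to seq itself. *)
Definition word (A : Type) : Type := seq A.

HB.instance Definition _ (A : choiceType) := Choice.on (word A).
HB.instance Definition _ (A : choiceType) :=
  isMonoid.Build (word A) (@catA A) (@cat0s A) (@cats0 A).

Definition Sigma : choiceType := 'I_2.

Record SL (n : nat) (R : comUnitRingType) : Type :=
  MkSL { SLval :> 'M[R]_n; _ : \det SLval == 1 }.

HB.instance Definition _ n R := [isSub for @SLval n R].
HB.instance Definition _ n R := [Choice of SL n R by <:].

Section SpecialLinear.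
Variables (n : nat) (R : comUnitRingType).
Implicit Types x y z : SL n R.

Lemma det_SL x : \det x = 1. Proof. exact/eqP/(valP x). Qed.

Lemma SL_unitmx x : val x \in unitmx.
Proof. by rewrite unitmxE det_SL unitr1. Qed.

Fact SL_one_subproof : \det (1%:M : 'M[R]_n) == 1.
Proof. by rewrite det1. Qed.

Fact SL_mul_subproof x y : \det (x *m y) == 1.
Proof. by rewrite det_mulmx !det_SL mulr1. Qed.

Fact SL_inv_subproof x : \det (invmx x) == 1.
Proof. by rewrite det_inv det_SL invr1. Qed.

Definition SL_one : SL n R := MkSL SL_one_subproof.
Definition SL_mul x y : SL n R := MkSL (SL_mul_subproof x y).
Definition SL_inv x : SL n R := MkSL (SL_inv_subproof x).

Fact SL_mulA : associative SL_mul.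
Proof. by move=> x y z; apply/val_inj/mulmxA. Qed.

Fact SL_mul1 : left_id SL_one SL_mul.
Proof. by move=> x; apply/val_inj/mul1mx. Qed.

Fact SL_mulr1 : right_id SL_one SL_mul.
Proof. by move=> x; apply/val_inj/mulmx1. Qed.

Fact SL_mulV : left_inverse SL_one SL_inv SL_mul.
Proof. by move=> x; apply/val_inj/mulVmx/SL_unitmx. Qed.

Fact SL_mulrV : right_inverse SL_one SL_inv SL_mul.
Proof. by move=> x; apply/val_inj/mulmxV/SL_unitmx. Qed.

HB.instance Definition _ :=
  isGroup.Build (SL n R) SL_mulA SL_mul1 SL_mulr1 SL_mulV SL_mulrV.

End SpecialLinear.

(* The 3 x 3 matrix with the given list of rows. *)
Definition mx3 (rows : seq (seq rat)) : 'M[rat]_3 :=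
  \matrix_(i, j) nth 0 (nth [::] rows i) j.

Definition phi_on_generators (f : word Sigma * word Sigma -> SL 3 rat) : Prop :=
  [/\ f ([:: 0 : 'I_2], [::]) = mx3 [:: [:: 4;    0;    0];
                                        [:: 0; 1 / 2;    0];
                                        [:: 0;    0; 1 / 2]] :> 'M_3,
      f ([:: 1 : 'I_2], [::]) = mx3 [:: [:: 9; 1 / 3;    0];
                                        [:: 0; 1 / 3;    0];
                                        [:: 0;    0; 1 / 3]] :> 'M_3,
      f ([::], [:: 0 : 'I_2]) = mx3 [:: [:: 1 / 2;    0; 0];
                                        [::    0; 1 / 2; 0];
                                        [::    0;    0; 4]] :> 'M_3
    & f ([::], [:: 1 : 'I_2]) = mx3 [:: [:: 1 / 3;    0; 0];
                                        [::    0; 1 / 3; 0];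
                                        [::    0; 1 / 3; 9]] :> 'M_3].

(* Main.v *)
(* Up to the scalar s = 1 / (weight u * weight v), the image of (u, v) is the matrix with
   rows [m, t, 0], [0, 1, 0], [0, t', m'], where x |-> m x + t is the composite
   along u of the affine maps x |-> 8 x (letter 0) and x |-> 27 x + 1
   (letter 1), and (m', t') is the same datum for v.  As the middle entry
   recovers s, it suffices that u is determined by (m, t).  One reads u from its
   end: appending 0 replaces (m, t) by (8 m, t), appending 1 by (27 m, t + m),
   and the invariant 26 t < m shows that these cases never collide. *)
Require Import Defs.
From HB Require Import structures.
From mathcomp Require Import all_boot all_order all_algebra all_fingroup.
From mathcomp Require Import ring zify.

Set Implicit Arguments.
Unset Strict Implicit.
Unset Printing Implicit Defensive.

Import GRing.Theory Num.Theory.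

(** Reciprocal of the middle entry of the letter's generators. Dividing by that entry leaves the
    multipliers 4 / (1/2) = 2^3 and 9 / (1/3) = 3^3, which is why [slope] is a cube. *)
Definition letter_weight (c : Sigma) : nat := if c == 0 :> nat then 2 else 3.

Fixpoint weight (u : seq Sigma) : nat :=
  if u is c :: v then letter_weight c * weight v else 1.

Definition slope (u : seq Sigma) : nat := weight u ^ 3.

Fixpoint offset (u : seq Sigma) : nat :=
  if u is c :: v then c + letter_weight c ^ 3 * offset v else 0.

Lemma SigmaP (P : Sigma -> Prop) :
  P (0%R : 'I_2) -> P (1%R : 'I_2) -> forall c, P c.
Proof.
move=> P0 P1; case=> -[|[|//]] lt_c.
- by rewrite (_ : Ordinal lt_c = 0%R :> 'I_2) //; apply: val_inj.
- by rewrite (_ : Ordinal lt_c = 1%R :> 'I_2) //; apply: val_inj.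
Qed.

Lemma weight_cat u v : weight (u ++ v) = weight u * weight v.
Proof. by elim: u => [|c u IHu] /=; rewrite ?mul1n // IHu mulnA. Qed.

Lemma weight_gt0 u : 0 < weight u.
Proof.
by elim: u => //= c u; rewrite muln_gt0 => ->; rewrite /letter_weight; case: ifP.
Qed.

Lemma slope_cat u v : slope (u ++ v) = slope u * slope v.
Proof. by rewrite /slope weight_cat expnMn. Qed.

Lemma slope_gt0 u : 0 < slope u.
Proof. by rewrite expn_gt0 weight_gt0. Qed.

Lemma offset_cat u v : offset (u ++ v) = offset u + slope u * offset v.
Proof.
elim: u => [|c u IHu] /=; first by rewrite mul1n.
by rewrite IHu /slope /= expnMn mulnDr addnA mulnA.
Qed.

Lemma slope_rcons u c : slope (rcons u c) = slope u * letter_weight c ^ 3.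
Proof. by rewrite -cats1 slope_cat /slope /= muln1. Qed.

Lemma offset_rcons u c : offset (rcons u c) = offset u + slope u * c.
Proof. by rewrite -cats1 offset_cat /= muln0 addn0. Qed.

(** The constant 26 = 27 - 1 is the one that appending 1 preserves: from 26 t < m follows 26 (t + m)
    < 27 m. *)
Lemma offset_lt_slope u : 26 * offset u < slope u.
Proof.
elim/last_ind: u => [|u c IHu] //; rewrite offset_rcons slope_rcons.
by elim/SigmaP: c; rewrite /letter_weight /=; lia.
Qed.

Lemma slope_offset_inj u v : slope u = slope v -> offset u = offset v -> u = v.
Proof.
elim/last_ind: u v => [|u c IHu] v; elim/last_ind: v => [|v d _] //;
  rewrite ?slope_rcons ?offset_rcons.
(* The empty word has slope 1, a nonempty word slope at least 8. *)
- have := slope_gt0 v; rewrite {2}/slope /=.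
  by elim/SigmaP: d; rewrite /letter_weight /=; lia.
- have := slope_gt0 u; rewrite {3}/slope /=.
  by elim/SigmaP: c; rewrite /letter_weight /=; lia.
(* Distinct last letters would give, up to symmetry, 8 m = 27 m' and t = t' + m', hence 26 m' <= 26
   t < m = (27/8) m', which is absurd. *)
have := (offset_lt_slope u, offset_lt_slope v) => -[ltu ltv].
elim/SigmaP: c; elim/SigmaP: d; rewrite /letter_weight /= => eq_s eq_o;
  try by exfalso; lia.
- by congr (rcons _ _); apply: IHu; lia.
- by congr (rcons _ _); apply: IHu; lia.
Qed.

Local Open Scope ring_scope.

Definition phi_mx (x : word Sigma * word Sigma) : 'M[rat]_3 :=
  let s := ((weight x.1)%:R * (weight x.2)%:R)^-1 in
  mx3 [:: [:: s * (slope x.1)%:R; s * (offset x.1)%:R; 0];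
          [:: 0; s; 0];
          [:: 0; s * (offset x.2)%:R; s * (slope x.2)%:R]].

Lemma weight_neq0 u : (weight u)%:R != 0 :> rat.
Proof. by rewrite pnatr_eq0 -lt0n weight_gt0. Qed.

(** The determinant is s^3 m m', and m, m' are the cubes of two weights with product 1/s. *)
Lemma phi_mx_det x : \det (phi_mx x) == 1.
Proof.
rewrite (expand_det_row _ 0) !big_ord_recl big_ord0 /cofactor.
rewrite !(expand_det_row _ 0) !big_ord_recl !big_ord0 /cofactor !det_mx11 !mxE /=.
rewrite /slope !natrX !expr2 /=.
have := (weight_neq0 x.1, weight_neq0 x.2) => -[n1 n2].
by apply/eqP; field; rewrite n1 n2.
Qed.

Definition phi (x : word Sigma * word Sigma) : SL 3 rat := MkSL (phi_mx_det x).

(** The scalars multiply, and each of the two triangular blocks sharing the middle entry composes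
    affine maps, as [offset_cat] does. *)
Lemma phi_mxM x y : phi_mx (x * y)%g = phi_mx x *m phi_mx y.
Proof.
case: x y => [u v] [u' v'].
have := (weight_neq0 u, weight_neq0 v, weight_neq0 u', weight_neq0 v').
move=> [[[nu nv] nu'] nv'].
apply/matrixP => i j; rewrite !mxE !big_ord_recl big_ord0 !mxE /=.
rewrite /= !weight_cat !slope_cat !offset_cat !natrD !natrM.
case: i j => [[|[|[|//]]] ?] [[|[|[|//]]] ?] /=; field; by rewrite ?nu ?nv ?nu' ?nv'.
Qed.

Fact phi_is_multiplicative : {morph phi : x y / (x * y)%g}.
Proof. by move=> x y; apply/val_inj/phi_mxM. Qed.

HB.instance Definition _ :=
  isMultiplicative.Build (word Sigma * word Sigma)%type (SL 3 rat) phi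
    phi_is_multiplicative.

Lemma phi_generators : phi_on_generators phi.
Proof.
by split; apply/matrixP => i j; rewrite !mxE;
  case: i j => [[|[|[|//]]] ?] [[|[|[|//]]] ?]; apply/eqP; vm_compute.
Qed.

Lemma phi_inj : injective phi.
Proof.
move=> [u v] [u' v'] /(congr1 val)/matrixP eq_mx.
have := eq_mx (inord 1) (inord 1); rewrite !mxE !inordK //= => eq_s.
have sP : ((weight u')%:R * (weight v')%:R)^-1 != 0 :> rat.
  by rewrite invr_eq0 mulf_neq0 ?weight_neq0.
(* Cancelling the common nonzero scalar turns equalities of rational entries into equalities of
   natural numbers. *)
have natI (m n : nat) : ((weight u)%:R * (weight v)%:R)^-1 * m%:R =
    ((weight u')%:R * (weight v')%:R)^-1 * n%:R :> rat -> m = n.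
  by rewrite eq_s => /(mulfI sP)/eqP; rewrite eqr_nat => /eqP.
have := eq_mx (inord 0) (inord 0); rewrite !mxE !inordK //= => /natI eq_su.
have := eq_mx (inord 0) (inord 1); rewrite !mxE !inordK //= => /natI eq_ou.
have := eq_mx (inord 2) (inord 2); rewrite !mxE !inordK //= => /natI eq_sv.
have := eq_mx (inord 2) (inord 1); rewrite !mxE !inordK //= => /natI eq_ov.
by rewrite (slope_offset_inj eq_su eq_ou) (slope_offset_inj eq_sv eq_ov).
Qed.

(** Gives the uniqueness of the morphism: (u, v) is the product of (u, [::]) and ([::], v), and each
    factor is a product of generators. *)
Lemma multiplicative_pair_words_ext (A : choiceType) (G : groupType)
    (f g : {multiplicative (word A * word A)%type -> G}) :
    (forall c, f ([:: c], [::]) = g ([:: c], [::])) ->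
    (forall c, f ([::], [:: c]) = g ([::], [:: c])) ->
  f =1 g.
Proof.
move=> eq1 eq2 [u v].
(* Only products are assumed to be preserved; the image of the unit is idempotent, hence trivial in
   a group. *)
have map1 (h : {multiplicative (word A * word A)%type -> G}) :
    h ([::], [::]) = 1%g.
  by apply: (mulgI (h ([::], [::]))); rewrite -gmulfM !mulg1.
have eq_nil : f ([::], [::]) = g ([::], [::]) by rewrite !map1.
have map_cat (h : {multiplicative (word A * word A)%type -> G})
    (u1 v1 u2 v2 : word A) :
    h (u1 ++ u2, v1 ++ v2) = (h (u1, v1) * h (u2, v2))%g.
  by rewrite -gmulfM.
have eq_l w : f (w, [::]) = g (w, [::]).
  elim: w => [|c w IHw] //.
  have := map_cat f [:: c] [::] w [::]; rewrite eq1 IHw => ->.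
  exact/esym/(map_cat g [:: c] [::] w [::]).
have eq_r w : f ([::], w) = g ([::], w).
  elim: w => [|c w IHw] //.
  have := map_cat f [::] [:: c] [::] w; rewrite eq2 IHw => ->.
  exact/esym/(map_cat g [::] [:: c] [::] w).
by rewrite -[u]cats0 -[v]cat0s !map_cat eq_l eq_r.
Qed.

Theorem theorem7 :
  exists phi : {multiplicative (word Sigma * word Sigma)%type -> SL 3 rat},
    [/\ phi_on_generators phi,
        (forall psi : {multiplicative (word Sigma * word Sigma)%type -> SL 3 rat},
           phi_on_generators psi -> psi =1 phi)
      & injective phi].
Proof.
exists phi; split; [exact: phi_generators | | exact: phi_inj].
move=> psi [psi0l psi1l psi0r psi1r].
have [phi0l phi1l phi0r phi1r] := phi_generators.
apply: multiplicative_pair_words_ext; apply: SigmaP; apply: val_inj => /=.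
- by rewrite psi0l -phi0l.
- by rewrite psi1l -phi1l.
- by rewrite psi0r -phi0r.
- by rewrite psi1r -phi1r.
Qed.
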